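(* For every integer $t\geq 0$ there exists a finite dimensional nilpotent Lie algebra $L$ over $\mathbb{F}$ such that $\dim L/Z(L)=d\,\dim L^{2}-t$, where $d$ is the minimal number of generators of $L/Z(L)$; that is, $t(L)=t$.
   Context: $\mathbb{F}$ is an arbitrary field. $L^{2}=[L,L]$ is the derived subalgebra and $Z(L)$ is the center of $L$. The minimal number of generators of a Lie algebra is the smallest cardinality of a set generating it as a Lie algebra (so it is $0$ for the zero algebra). For a finite dimensional nilpotent Lie algebra $L$, with $d$ the minimal number of generators of $L/Z(L)$, the integer $t(L)$ is defined by $\dim L/Z(L)=d\,\dim L^{2}-t(L)$. *)

(* Defs.v *)
From HB Require Import structures.
From mathcomp Require Import all_boot all_order all_algebra.
From mathcomp Require Import boolp.

Set Implicit Arguments.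
Unset Strict Implicit.
Unset Printing Implicit Defensive.

Import GRing.Theory VectorInternalTheory.
Local Open Scope ring_scope.

Reserved Notation "[ 'lie' x , y ]" (format "[ 'lie'  x ,  y ]").

(* Alternation is stated as [x, x] = 0, not as anticommutativity, which is     *)
(* weaker in characteristic 2.                                                 *)
HB.mixin Record Lmodule_isLie (F : fieldType) (L : Type)
    of GRing.Lmodule F L := {
  bracket : L -> L -> L;
  bracket_linearl : forall y, linear (fun x => bracket x y);
  bracket_linearr : forall x, linear (bracket x);
  bracketxx : forall x, bracket x x = 0;
  bracket_jacobi : forall x y z,
    bracket x (bracket y z) + bracket y (bracket z x)
      + bracket z (bracket x y) = 0
}.

#[short(type="lieType")]
HB.structure Definition Lie (F : fieldType) :=
  {L of Lmodule_isLie F L & GRing.Lmodule F L}.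

#[short(type="finLieType")]
HB.structure Definition FinLie (F : fieldType) :=
  {L of Lie F L & Vector F L}.

Notation "[ 'lie' x , y ]" := (bracket x y) : ring_scope.

Section LieTheory.
Variables (F : fieldType) (L : lieType F).
Implicit Types x y z : L.

Definition lbracket y x := [lie x, y].

HB.instance Definition _ x :=
  GRing.isLinear.Build F L L *:%R (bracket x) (bracket_linearr x).
HB.instance Definition _ y :=
  GRing.isLinear.Build F L L *:%R (lbracket y) (bracket_linearl y).

Lemma bracketDl x y z : [lie x + y, z] = [lie x, z] + [lie y, z].
Proof. exact: (linearD (lbracket z)). Qed.

Lemma bracketDr x y z : [lie x, y + z] = [lie x, y] + [lie x, z].
Proof. exact: linearD. Qed.

Lemma bracketZl a x y : [lie a *: x, y] = a *: [lie x, y].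
Proof. exact: (linearZ_LR (lbracket y)). Qed.

Lemma bracketZr a x y : [lie x, a *: y] = a *: [lie x, y].
Proof. exact: linearZ_LR. Qed.

Lemma bracketBl x y z : [lie x - y, z] = [lie x, z] - [lie y, z].
Proof. exact: (linearB (lbracket z)). Qed.

Lemma bracketBr x y z : [lie x, y - z] = [lie x, y] - [lie x, z].
Proof. exact: linearB. Qed.

Lemma bracket_suml (J : Type) (r : seq J) (P : pred J) (f : J -> L) y :
  [lie \sum_(j <- r | P j) f j, y] = \sum_(j <- r | P j) [lie f j, y].
Proof. exact: (linear_sum (lbracket y)). Qed.

Lemma bracket_sumr (J : Type) (r : seq J) (P : pred J) (f : J -> L) x :
  [lie x, \sum_(j <- r | P j) f j] = \sum_(j <- r | P j) [lie x, f j].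
Proof. exact: linear_sum. Qed.

Lemma bracketC x y : [lie x, y] = - [lie y, x].
Proof.
have := bracketxx (x + y); rewrite bracketDl !bracketDr !bracketxx add0r addr0.
by move/eqP; rewrite addr_eq0 => /eqP.
Qed.

End LieTheory.

Section FinLieTheory.
Variables (F : fieldType) (L : finLieType F).
Implicit Types (x y : L) (U V W I : {vspace L}).

(* The span of the brackets [u, v], u in U and v in V (see lievP).             *)
Definition liev U V : {vspace L} :=
  <<[seq [lie x, y] | x <- vbasis U, y <- vbasis V]>>%VS.

Lemma memv_lie U V x y : x \in U -> y \in V -> [lie x, y] \in liev U V.
Proof.
move=> /coord_vbasis-> /coord_vbasis->.
rewrite bracket_suml memv_suml // => i _.
rewrite bracket_sumr memv_suml // => j _.
rewrite bracketZl bracketZr !memvZ // memv_span //.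
by apply/allpairsP; exists ((vbasis U)`_i, (vbasis V)`_j); rewrite !memt_nth.
Qed.

Lemma lievP U V W :
  reflect (forall u v, u \in U -> v \in V -> [lie u, v] \in W)
          (liev U V <= W)%VS.
Proof.
apply: (iffP idP) => [sUVW u v Uu Vv|sUVW].
  exact: (subvP sUVW) (memv_lie Uu Vv).
apply/span_subvP=> _ /allpairsP[[u v] /= [Uu Vv ->]].
by rewrite sUVW ?vbasis_mem.
Qed.

Definition derived : {vspace L} := liev fullv fullv.

(* lcs i is L^{i+1}.                                                           *)
Definition lcs (i : nat) : {vspace L} := iter i (fun U => liev U fullv) fullv.

Definition nilpotent : Prop := exists i, lcs i = 0%VS.

Definition center : {vspace L} :=
  (\bigcap_(y <- vbasis fullv) lker (linfun (@lbracket F L y)))%VS.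

Lemma centerP x : reflect (forall y, [lie x, y] = 0) (x \in center).
Proof.
rewrite /center memvE; apply: (iffP idP) => [|Zx].
  rewrite big_tnth => /subv_bigcapP Zx y.
  rewrite (coord_vbasis (memvf y)) bracket_sumr big1 // => i _.
  have /= := Zx (cast_ord (esym (size_tuple _)) i) isT.
  rewrite -memvE memv_ker lfunE /= /lbracket (tnth_nth 0) /= => /eqP Zxi.
  by rewrite bracketZr Zxi scaler0.
rewrite big_tnth; apply/subv_bigcapP=> i _.
by rewrite -memvE memv_ker lfunE /= /lbracket Zx.
Qed.

Definition subalgebra U : Prop := (liev U U <= U)%VS.

(* The subalgebra generated by s, i.e., the intersection of the subalgebras    *)
(* containing s, is L. In finite dimension all subspaces are {vspace L}.       *)
Definition generates (s : seq L) : Prop :=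
  forall U, subalgebra U -> {subset s <= U} -> U = fullv.

Lemma generates_vbasis : generates (vbasis (fullv : {vspace L})).
Proof.
move=> U _ sXU; apply/eqP; rewrite eqEsubv subvf /=.
by rewrite -(span_basis (vbasisP fullv)); apply/span_subvP.
Qed.

(* Duplicate-free sequences stand for finite sets; infinite generating sets    *)
(* are irrelevant to the minimum since L is finite dimensional.                *)
Definition has_gens (n : nat) : bool :=
  `[< exists s : seq L, [/\ uniq s, size s = n & generates s] >].

Lemma ex_has_gens : exists n, has_gens n.
Proof.
exists (\dim (fullv : {vspace L})); apply/asboolP; exists (vbasis fullv).
by split; [exact/free_uniq/basis_free/vbasisP | rewrite size_tuple
  | exact: generates_vbasis].
Qed.

Definition mingen : nat := ex_minn ex_has_gens.

Record ideal := Ideal {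
  ideal_vspace :> {vspace L};
  idealP : (liev fullv ideal_vspace <= ideal_vspace)%VS
}.

Lemma center_ideal : (liev fullv center <= center)%VS.
Proof.
apply/lievP=> x z _ /centerP Zz.
by apply/centerP=> y; rewrite (bracketC x) Zz oppr0 -(scale0r x) bracketZl
  !scale0r.
Qed.

Canonical centerI : ideal := Ideal center_ideal.

End FinLieTheory.

Arguments derived {F} L.
Arguments center {F} L.
Arguments centerI {F} L.
Arguments nilpotent {F} L.
Arguments mingen {F} L.
Arguments generates {F L} s.

Section Quotient.
Local Open Scope quotient_scope.
Variables (F : fieldType) (L : finLieType F) (I : ideal L).

(* L / I proper: classes of x ~ y := x - y \in I, not a model on a complement. *)
Definition lieQuot : Type := Quotient.quot (pred_of_vspace I).
HB.instance Definition _ := Choice.on lieQuot.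
HB.instance Definition _ := GRing.Zmodule.on lieQuot.
HB.instance Definition _ := EqQuotient.on lieQuot.

Definition lieproj (x : L) : lieQuot := \pi x.

Lemma lieprojP x y : reflect (lieproj x = lieproj y) (x - y \in (I : {vspace L})).
Proof.
have -> : x - y \in (I : {vspace L}) = (lieproj x == lieproj y).
  exact: (Quotient.idealrBE (pred_of_vspace I)).
exact: eqP.
Qed.

Lemma lieprojK (q : lieQuot) : lieproj (repr q) = q.
Proof. exact: reprK. Qed.

Lemma repr_lieproj x : repr (lieproj x) - x \in (I : {vspace L}).
Proof. by apply/lieprojP; rewrite lieprojK. Qed.

Lemma lieprojD x y : lieproj (x + y) = lieproj x + lieproj y.
Proof. exact: (Quotient.pi_add (pred_of_vspace I)). Qed.

Definition quot_scale (a : F) (q : lieQuot) : lieQuot := lieproj (a *: repr q).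

Lemma lieprojZ_subproof a x : quot_scale a (lieproj x) = lieproj (a *: x).
Proof. by apply/lieprojP; rewrite -scalerBr memvZ // repr_lieproj. Qed.

Definition quot_bracket (p q : lieQuot) : lieQuot :=
  lieproj [lie repr p, repr q].

Lemma memv_ideall x y : y \in (I : {vspace L}) -> [lie x, y] \in (I : {vspace L}).
Proof. by move=> Iy; apply: (subvP (idealP I)); apply: memv_lie (memvf x) Iy. Qed.

Lemma memv_idealr x y : x \in (I : {vspace L}) -> [lie x, y] \in (I : {vspace L}).
Proof. by move=> Ix; rewrite bracketC memvN memv_ideall. Qed.

Lemma lieproj_bracket_subproof x y :
  quot_bracket (lieproj x) (lieproj y) = lieproj [lie x, y].
Proof.
apply/lieprojP; set x' := repr _; set y' := repr _.
have -> : [lie x', y'] - [lie x, y] = [lie x' - x, y'] + [lie x, y' - y].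
  by rewrite bracketBl bracketBr addrA subrK.
by apply: memvD; [apply: memv_idealr | apply: memv_ideall]; apply: repr_lieproj.
Qed.

Lemma quot_scaleA a b q : quot_scale a (quot_scale b q) = quot_scale (a * b) q.
Proof. by rewrite -[q]lieprojK !lieprojZ_subproof scalerA. Qed.

Lemma quot_scale1 : left_id 1 quot_scale.
Proof. by move=> q; rewrite -[q]lieprojK lieprojZ_subproof scale1r. Qed.

Lemma quot_scaleDr : right_distributive quot_scale +%R.
Proof.
move=> a p q; rewrite -[p]lieprojK -[q]lieprojK -lieprojD !lieprojZ_subproof.
by rewrite scalerDr lieprojD.
Qed.

Lemma quot_scaleDl q : {morph quot_scale^~ q : a b / a + b}.
Proof.
by move=> a b; rewrite -[q]lieprojK !lieprojZ_subproof scalerDl lieprojD.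
Qed.

HB.instance Definition _ := GRing.Zmodule_isLmodule.Build F lieQuot
  quot_scaleA quot_scale1 quot_scaleDr quot_scaleDl.

Lemma lieprojZ a x : lieproj (a *: x) = a *: lieproj x.
Proof. by rewrite -lieprojZ_subproof. Qed.

Fact lieproj_is_linear : linear lieproj.
Proof. by move=> a x y; rewrite lieprojD lieprojZ. Qed.
HB.instance Definition _ :=
  GRing.isLinear.Build F L lieQuot *:%R lieproj lieproj_is_linear.

Lemma quot_bracket_linearl q : linear (fun p => quot_bracket p q).
Proof.
move=> a p p'; rewrite -[p]lieprojK -[p']lieprojK -[q]lieprojK -lieprojZ.
rewrite -lieprojD !lieproj_bracket_subproof bracketDl bracketZl.
by rewrite lieprojD lieprojZ.
Qed.

Lemma quot_bracket_linearr p : linear (quot_bracket p).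
Proof.
move=> a q q'; rewrite -[q]lieprojK -[q']lieprojK -[p]lieprojK -lieprojZ.
rewrite -lieprojD !lieproj_bracket_subproof bracketDr bracketZr.
by rewrite lieprojD lieprojZ.
Qed.

Lemma quot_bracketxx q : quot_bracket q q = 0.
Proof.
by rewrite -[q]lieprojK lieproj_bracket_subproof bracketxx linear0.
Qed.

Lemma quot_bracket_jacobi p q r :
  quot_bracket p (quot_bracket q r) + quot_bracket q (quot_bracket r p)
    + quot_bracket r (quot_bracket p q) = 0.
Proof.
rewrite -[p]lieprojK -[q]lieprojK -[r]lieprojK !lieproj_bracket_subproof.
by rewrite -!lieprojD bracket_jacobi linear0.
Qed.

HB.instance Definition _ := Lmodule_isLie.Build F lieQuot
  quot_bracket_linearl quot_bracket_linearr quot_bracketxx quot_bracket_jacobi.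

Lemma lieproj_bracket x y : lieproj [lie x, y] = [lie lieproj x, lieproj y].
Proof. by rewrite -lieproj_bracket_subproof. Qed.

(* The finite dimensional structure comes from the isomorphism between L / I   *)
(* and a complement C of I.                                                    *)
Let C : {vspace L} := (I^C)%VS.
Let pC : L -> subvs_of C := vsproj C \o daddv_pi C I.

Let capCI : (C :&: I)%VS = 0%VS.
Proof. by rewrite capvC capv_compl. Qed.

Let memv_subC x : x - daddv_pi C I x \in (I : {vspace L}).
Proof.
rewrite -{1}[x](daddv_pi_add capCI) ?[(C + I)%VS]addvC ?addv_complf ?memvf //.
by rewrite addrC addKr memv_pi.
Qed.

Let pC_lieproj x : pC (repr (lieproj x)) = pC x.
Proof.
congr (vsproj C _); apply/eqP; rewrite -subr_eq0 -linearB -memv0 -capCI.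
set y := _ - x; rewrite memv_cap memv_pi /= -(subrK y (daddv_pi C I y)).
by rewrite -opprB memvD ?memvN ?memv_subC ?repr_lieproj.
Qed.

Fact lieQuot_vector_axiom : vector_axiom_def (dim (subvs_of C)) lieQuot.
Proof.
exists (fun q => v2r (pC (repr q))).
  move=> a p q; rewrite -[p]lieprojK -[q]lieprojK -lieprojZ -lieprojD.
  by rewrite !pC_lieproj /pC /= !linearP.
exists (fun r => lieproj (vsval (r2v r : subvs_of C))) => [q|r].
  rewrite v2rK /pC /= vsprojK ?memv_pi // -[RHS]lieprojK.
  by apply/esym/lieprojP/memv_subC.
by rewrite pC_lieproj /pC /= daddv_pi_id ?subvsP // vsvalK r2vK.
Qed.

HB.instance Definition _ := Lmodule_hasFinDim.Build F lieQuot
  lieQuot_vector_axiom.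

Lemma dim_lieQuot : \dim {:lieQuot} = (\dim {:L} - \dim I)%N.
Proof. by rewrite -dimv_compl !dimvf. Qed.

End Quotient.

(* An integer: the difference is not truncated.                                *)
Definition t_inv (F : fieldType) (L : finLieType F) : int :=
  (mingen (lieQuot (centerI L)) * \dim (derived L))%:Z
    - (\dim {:lieQuot (centerI L)})%:Z.

(* Main.v *)
Require Import Defs.
From HB Require Import structures.
From mathcomp Require Import all_boot all_order all_algebra.
From mathcomp Require Import boolp zify.

(** The standard filiform Lie algebra of dimension [t + 3] has invariant [t].
    It has a basis [x, e_0, ..., e_(t+1)], the only nonzero brackets of basis
    vectors (up to sign) being [[x, e_i] = e_(i+1)] for [i <= t].  It is
    nilpotent, its derived subalgebra is spanned by [e_1, ..., e_(t+1)] and its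
    center by [e_(t+1)], so that [dim L / Z(L) = t + 2] and [dim L^2 = t + 1].
    Finally [L / Z(L)] is generated by the classes of [x] and [e_0], and by no
    fewer elements since one element only generates the line it spans, whereas
    [dim L / Z(L) >= 2] ([mingen_gt1]); thus [d = 2] and [2 (t + 1) - t = t + 2].

    This algebra is the extension of an abelian algebra [V] by one derivation
    [f], and each of its features comes from a property of [f]: the derived
    subalgebra is the image of [f] ([derived_ext]), the center is its kernel
    ([center_ext]), nilpotency of [f] gives nilpotency ([nilpotent_ext]) and a
    cyclic vector of [f] gives two generators ([mingen_quot_ext]).  It remains
    to take for [f] a nilpotent Jordan block of size [t + 2]. *)

Set Implicit Arguments.
Unset Strict Implicit.
Unset Printing Implicit Defensive.

Import GRing.Theory.
Local Open Scope ring_scope.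

(** * Extension of an abelian Lie algebra by one derivation *)

(** The semidirect product of the abelian Lie algebra [V] with a line that acts
    through [f].  The endomorphism is a parameter of the type so that the
    bracket can be inferred from it. *)
Definition ext (F : fieldType) (V : vectType F) (f : 'End(V)) : Type :=
  (F^o * V)%type.

Section Extension.
Variables (F : fieldType) (V : vectType F) (f : 'End(V)).

HB.instance Definition _ := Vector.on (ext f).

Definition ext_bracket (p q : ext f) : ext f :=
  (0, f ((p.1 : F) *: q.2 - (q.1 : F) *: p.2)).

Lemma ext_bracketxx p : ext_bracket p p = 0.
Proof. by rewrite /ext_bracket subrr linear0. Qed.

Lemma ext_bracketC p q : ext_bracket p q = - ext_bracket q p.
Proof.
rewrite /ext_bracket; apply/pair_equal_spec; split=> /=; first by rewrite oppr0.
by rewrite -opprB linearN.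
Qed.

Lemma ext_bracket_linearr p : linear (ext_bracket p).
Proof.
move=> a q r; apply/pair_equal_spec; split=> /=; first by rewrite scaler0 addr0.
rewrite -[RHS](linearP f); congr (f _).
rewrite scalerDr scalerDl scalerBr !scalerA [p.1 * a]mulrC opprD.
by rewrite addrACA.
Qed.

Lemma ext_bracket_linearl q : linear (fun p => ext_bracket p q).
Proof.
move=> a p r; rewrite !(ext_bracketC _ q) ext_bracket_linearr.
by rewrite opprD scalerN.
Qed.

Lemma ext_bracket_jacobi p q r :
  ext_bracket p (ext_bracket q r) + ext_bracket q (ext_bracket r p)
    + ext_bracket r (ext_bracket p q) = 0.
Proof.
apply/pair_equal_spec; split=> /=; first by rewrite !addr0.
rewrite !scale0r !subr0 -!linearZ -!linearD -[RHS](linear0 f); congr (f _).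
rewrite -[RHS](linear0 f); congr (f _).
rewrite !scalerBr !scalerA [q.1 * p.1]mulrC [r.1 * p.1]mulrC [r.1 * q.1]mulrC.
by rewrite [X in X + _ = _]addrC !subrKA subrr.
Qed.

HB.instance Definition _ := Lmodule_isLie.Build F (ext f)
  ext_bracket_linearl ext_bracket_linearr ext_bracketxx ext_bracket_jacobi.

Definition ext_in (v : V) : ext f := (0, v).

Definition ext_der : ext f := (1, 0).

Fact ext_in_is_linear : linear ext_in.
Proof.
move=> a u v; rewrite /ext_in; apply/pair_equal_spec; split=> //=.
by rewrite scaler0 addr0.
Qed.

HB.instance Definition _ :=
  GRing.isLinear.Build F V (ext f) *:%R ext_in ext_in_is_linear.

Lemma extE (p : ext f) : p = (p.1 : F) *: ext_der + ext_in p.2.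
Proof.
case: p => a v; apply/pair_equal_spec; split=> /=.
  by rewrite addr0; apply/esym/mulr1.
by rewrite scaler0 add0r.
Qed.

Lemma bracket_der_in v : [lie ext_der, ext_in v] = ext_in (f v).
Proof. by congr (0, f _); rewrite /= scale1r scale0r subr0. Qed.

Definition in_img (W : {vspace V}) : {vspace ext f} := (linfun ext_in @: W)%VS.

Lemma in_imgP (W : {vspace V}) (p : ext f) :
  reflect (p.1 = 0 /\ p.2 \in W) (p \in in_img W).
Proof.
apply: (iffP memv_imgP) => [[v Wv ->]|[p1 Wp]]; first by rewrite lfunE.
by exists p.2; rewrite // lfunE [LHS]extE p1 scale0r add0r.
Qed.

Lemma dim_in_img (W : {vspace V}) : \dim (in_img W) = \dim W.
Proof.
apply: limg_dim_eq; apply/eqP; rewrite -subv0; apply/subvP=> v.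
rewrite memv_cap memv_ker lfunE /= => /andP[_ /eqP[->]]; exact: mem0v.
Qed.

Lemma dim_ext : \dim {:ext f} = (\dim {:V}).+1.
Proof. by rewrite !dimvf. Qed.

(** Every bracket is a value of [f] by definition, and [f v] is the bracket of
    the acting element with [v]. *)
Lemma derived_ext : derived (ext f) = in_img (limg f).
Proof.
apply/eqP; rewrite eqEsubv; apply/andP; split.
  by apply/lievP=> p q _ _; apply/in_imgP; split=> //=; exact/memv_img/memvf.
apply/subvP=> p /in_imgP[p1 /memv_imgP[v _ p2]].
by rewrite [p]extE p1 scale0r add0r p2 -bracket_der_in memv_lie ?memvf.
Qed.

(** Commuting with the acting element forces the second component into the
    kernel of [f]; commuting with [V] makes the first component multiply [f] to
    zero, which is where [f != 0] enters: for [f = 0] the algebra is abelian. *)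
Lemma center_ext : f != 0 -> center (ext f) = in_img (lker f).
Proof.
move=> nz_f; apply/vspaceP=> p; apply/centerP/in_imgP => [Zp|[p1]].
  split; last first.
    have := Zp ext_der; rewrite bracketC => /eqP; rewrite oppr_eq0 => /eqP[].
    by rewrite /= scale1r scaler0 subr0 => fp; rewrite memv_ker fp.
  apply/eqP; apply: contraNT nz_f => p1; apply/eqP/lfunP=> v.
  have [/eqP] := Zp (ext_in v).
  rewrite /= scale0r subr0 linearZ scaler_eq0 (negPf p1) /= lfunE => /eqP; exact.
rewrite memv_ker => /eqP fp q; apply/pair_equal_spec; split=> //=.
by rewrite p1 scale0r sub0r linearN linearZ /= fp scaler0 oppr0.
Qed.

(** The lower central series descends along the images of the powers of [f]. *)
Lemma nilpotent_ext k : (forall v, iter k f v = 0) -> nilpotent (ext f).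
Proof.
move=> fk0; pose W i : {vspace V} := iter i (fun U => f @: U)%VS fullv.
have lcsW i : (lcs (ext f) i.+1 <= in_img (W i.+1))%VS.
  elim: i => [|i IHi]; first by rewrite -derived_ext.
  apply/lievP=> p q /(subvP IHi)/in_imgP[p1 Wp] _; apply/in_imgP; split=> //=.
  by rewrite p1 scale0r sub0r memv_img // memvN memvZ.
have WP i w : w \in W i -> exists v, w = iter i f v.
  elim: i w => [|i IHi] w; first by exists w.
  by case/memv_imgP=> u /IHi[v ->] ->; exists v.
exists k.+1; apply/eqP; rewrite -subv0; apply/subvP=> p /(subvP (lcsW k)).
case/in_imgP=> p1 /WP[v p2].
by rewrite [p]extE p1 scale0r add0r p2 /= fk0 !linear0 mem0v.
Qed.

(** By [center_ext] the dimension is [1 + dim V - dim (lker f)]; rank-nullity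
    then gives this form. *)
Lemma dim_quot_ext : f != 0 ->
  \dim {:lieQuot (centerI (ext f))} = (\dim (limg f)).+1.
Proof.
move=> nz_f.
rewrite dim_lieQuot dim_ext [ideal_vspace _]center_ext // dim_in_img.
by rewrite -(limg_ker_dim f fullv) capfv addnC subSn ?leq_addl // addnK.
Qed.

(** The hypothesis on [e] says that it is a cyclic vector of [f]; the vectors of
    [V] whose classes lie in a given subalgebra containing the class of the
    acting element form an [f]-stable subspace. *)
Lemma has_gens_quot_ext e : f != 0 ->
    (forall W : {vspace V}, e \in W -> (f @: W <= W)%VS -> W = fullv) ->
  has_gens (lieQuot (centerI (ext f))) 2.
Proof.
move=> nz_f cyc_e; set Q := lieQuot _; set pr := @lieproj F _ (centerI (ext f)).
apply/asboolP; exists [:: pr ext_der; pr (ext_in e)]; split=> //.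
  (* The two classes differ because elements of the center have no component
     along the acting line. *)
  rewrite /= andbT inE; apply/eqP=> /lieprojP.
  rewrite [ideal_vspace _]center_ext // => /in_imgP[/= /eqP].
  by rewrite subr0 oner_eq0.
move=> U subU sU.
have Ux : pr ext_der \in U by rewrite sU // inE eqxx.
have Ue : pr (ext_in e) \in U by rewrite sU // !inE eqxx orbT.
have UV v : pr (ext_in v) \in U.
  pose g : 'Hom(V, Q) := linfun (pr \o ext_in).
  suffices: v \in (g @^-1: U)%VS by rewrite -memv_preim lfunE.
  rewrite (cyc_e (g @^-1: U)%VS) ?memvf // -?memv_preim ?lfunE //.
  apply/subvP=> _ /memv_imgP[w + ->]; rewrite -!memv_preim !lfunE /= => Uw.
  rewrite -bracket_der_in /pr lieproj_bracket.
  exact: (subvP subU) (memv_lie Ux Uw).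
apply/eqP; rewrite eqEsubv subvf /=; apply/subvP=> q _.
by rewrite -[q]lieprojK [repr q]extE lieprojD lieprojZ memvD ?memvZ.
Qed.

End Extension.

(** A single element spans an abelian subalgebra, of dimension at most one. *)
Lemma mingen_gt1 (F : fieldType) (L : finLieType F) :
  (1 < \dim {:L})%N -> (1 < mingen L)%N.
Proof.
move=> dimL; rewrite /mingen; case: ex_minnP => n /asboolP[s [_ <- gen_s]] _.
rewrite ltnNge; apply: contraTN dimL => le_s1; rewrite -leqNgt.
rewrite -(gen_s <<s>>%VS); last exact: memv_span.
  exact: leq_trans (dim_span s) le_s1.
case: s le_s1 {gen_s} => [|q [|//]] _; apply/lievP=> u v.
  rewrite span_nil !memv0 => /eqP-> _.
  by rewrite -(scale0r (0 : L)) bracketZl !scale0r.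
rewrite span_seq1 => /vlineP[a ->] /vlineP[b ->].
by rewrite bracketZl bracketZr bracketxx !scaler0 mem0v.
Qed.

Lemma mingen_quot_ext (F : fieldType) (V : vectType F) (f : 'End(V)) e :
    f != 0 ->
    (forall W : {vspace V}, e \in W -> (f @: W <= W)%VS -> W = fullv) ->
  mingen (lieQuot (centerI (ext f))) = 2.
Proof.
move=> nz_f cyc_e; apply/eqP; rewrite eqn_leq mingen_gt1 ?andbT.
  rewrite /mingen; case: ex_minnP => n _; apply.
  exact: has_gens_quot_ext cyc_e.
rewrite dim_quot_ext // ltnS lt0n dimv_eq0 -lkerE.
apply: contraNN nz_f => /subvP kf; apply/eqP/lfunP=> v.
by rewrite zero_lfunE; apply/eqP; rewrite -memv_ker kf ?memvf.
Qed.

(** * The nilpotent Jordan block *)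

Section Shift.
Variables (F : fieldType) (n : nat).

(** Maps the basis vector [e_i] to [e_(i+1)], and the last one to [0]. *)
Definition shift_row (v : 'rV[F]_n.+1) : 'rV[F]_n.+1 :=
  \row_j if j == 0 then 0 else v 0 (inord j.-1).

Fact shift_row_is_linear : linear shift_row.
Proof.
move=> a u v; apply/rowP=> j; rewrite !mxE.
by case: eqP; rewrite // mulr0 addr0.
Qed.

HB.instance Definition _ :=
  GRing.isLinear.Build F 'rV[F]_n.+1 'rV[F]_n.+1 *:%R shift_row
    shift_row_is_linear.

Definition shift : 'End('rV[F]_n.+1) := linfun shift_row.

Lemma shiftE v j :
  shift v 0 j = if j == 0 then 0 else v 0 (inord j.-1).
Proof. by rewrite lfunE mxE. Qed.

Lemma iter_shift v k (j : 'I_n.+1) : (j < k)%N -> iter k shift v 0 j = 0.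
Proof.
elim: k j => // k IHk j; rewrite ltnS iterS shiftE => le_jk.
case: eqP => // /eqP j0; rewrite IHk // inordK.
  by rewrite prednK // lt0n.
exact: leq_ltn_trans (leq_pred _) (ltn_ord j).
Qed.

Lemma shift_nilpotent v : iter n.+1 shift v = 0.
Proof. by apply/rowP=> j; rewrite iter_shift ?mxE. Qed.

Lemma shift_delta i :
  (i < n)%N -> shift (delta_mx 0 (inord i)) = delta_mx 0 (inord i.+1).
Proof.
move=> lt_in; apply/rowP=> j; rewrite shiftE !mxE eqxx /=.
have [->|j0] := eqVneq j 0.
  by rewrite -val_eqE /= inordK.
have j_gt0 : (0 < j)%N by rewrite lt0n.
rewrite -!val_eqE /= !inordK ?(leqW lt_in) //.
  by rewrite -(prednK j_gt0).
exact: leq_ltn_trans (leq_pred _) (ltn_ord j).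
Qed.

Lemma shift_cyclic (W : {vspace 'rV[F]_n.+1}) :
  delta_mx 0 0 \in W -> (shift @: W <= W)%VS -> W = fullv.
Proof.
move=> We sW.
have Wd i : (i <= n)%N -> delta_mx 0 (inord i) \in W.
  elim: i => [|i IHi] le_in; first by rewrite -(inord_val (0 : 'I_n.+1)) in We.
  rewrite -shift_delta //; apply: (subvP sW).
  by apply/memv_img/IHi/ltnW.
apply/eqP; rewrite eqEsubv subvf /=; apply/subvP=> v _.
rewrite [v]row_sum_delta memv_suml // => j _.
by rewrite memvZ // -[j]inord_val Wd // -ltnS.
Qed.

Lemma lker_shift : lker shift = <[delta_mx 0%R ord_max]>%VS.
Proof.
apply/vspaceP=> v; rewrite memv_ker; apply/eqP/vlineP=> [fv0|[a ->]].
  exists (v 0 ord_max); apply/rowP=> j; rewrite !mxE eqxx /=.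
  have [->|j_max] := eqVneq j ord_max; first by rewrite mulr1.
  have lt_jn : (j < n)%N by rewrite ltn_neqAle j_max -ltnS ltn_ord.
  have := congr1 (fun w : 'rV_n.+1 => w 0 (inord j.+1)) fv0.
  rewrite shiftE -val_eqE /= inordK // inord_val mulr0 mxE; exact.
apply/rowP=> j; rewrite shiftE !mxE; case: eqP => // /eqP j0.
rewrite eqxx -val_eqE /= inordK; last first.
  exact: leq_ltn_trans (leq_pred _) (ltn_ord j).
have j_gt0 : (0 < j)%N by rewrite lt0n.
by rewrite -eqSS prednK // ltn_eqF ?ltn_ord // mulr0.
Qed.

Lemma dim_limg_shift : \dim (limg shift) = n.
Proof.
have := limg_ker_dim shift fullv; rewrite capfv lker_shift dim_vline dimvf.
rewrite -[dim _]/(1 * n.+1)%N mul1n.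
suffices -> : delta_mx 0 ord_max != 0 :> 'rV[F]_n.+1 by case.
by apply/eqP=> /rowP/(_ ord_max)/eqP; rewrite !mxE !eqxx oner_eq0.
Qed.

End Shift.

(** * The filiform algebras *)

Theorem theorem2p10 (F : fieldType) (t : int) :
  0 <= t ->
  exists L : finLieType F,
    [/\ nilpotent L,
        (\dim {:lieQuot (centerI L)})%:Z
          = (mingen (lieQuot (centerI L)))%:Z * (\dim (derived L))%:Z - t
      & t_inv L = t].
Proof.
case: t => // n _.
(* The block acts on a space of dimension [n.+2], hence has rank [n.+1]. *)
pose f := shift F n.+1; exists (ext f).
have dim_f : \dim (limg f) = n.+1 by exact: dim_limg_shift.
have nz_f : f != 0.
  by apply: contra_eqN dim_f => /eqP->; rewrite lim0g dimv0.
have dimQ := dim_quot_ext nz_f.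
have dQ := mingen_quot_ext nz_f (@shift_cyclic F n.+1).
have dimD : \dim (derived (ext f)) = n.+1 by rewrite derived_ext dim_in_img.
split; first exact/nilpotent_ext/shift_nilpotent.
  by rewrite dimQ dQ dimD dim_f; lia.
by rewrite /t_inv dimQ dQ dimD dim_f; lia.
Qed.
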